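(* Let $\psi_1:(0,\infty)\to(0,\infty)$ be a measurable function, let $Z_1^*=S_1/S_2$, and consider the estimator $\delta_{\psi_1}=\psi_1(Z_1^* )S_2$ of $\sigma_2^2$. Put $$\psi_{11}^{E}(z_1^* )=\frac{1+z_1^*}{(m_1+m_2+2)\,E(\tau^{-1})}.$$ If $P\left(\psi_{11}^{E}(Z_1^* )>\psi_1(Z_1^* )\right)>0$, then the estimator $$\delta_{S1}^{E*}=\max\left\{\psi_1(Z_1^* ),\psi_{11}^{E}(Z_1^* )\right\}S_2$$ dominates $\delta_{\psi_1}$ with respect to the entropy loss $L_2$.
   Context: Model: $p,q,m_1,m_2$ are positive integers; $\tau$ is a positive random variable (mixing variable) with known distribution $\Pi$ on $(0,\infty)$, such that $E(\tau^{-1})$ is finite. Conditionally on $\tau$, the variables $\boldsymbol X_1,S_1,\boldsymbol X_2,S_2$ are independent with $\boldsymbol X_1\sim N_p(\boldsymbol\theta_1,\frac{\sigma_1^2}{\tau}I)$, $S_1\sim\frac{\sigma_1^2}{\tau}\chi^2_{m_1}$, $\boldsymbol X_2\sim N_q(\boldsymbol\theta_2,\frac{\sigma_2^2}{\tau}I)$, $S_2\sim\frac{\sigma_2^2}{\tau}\chi^2_{m_2}$ (the same $\tau$ for all four). The unknown parameters are $\boldsymbol\theta_1\in\mathbb R^p$, $\boldsymbol\theta_2\in\mathbb R^q$, $\sigma_1,\sigma_2>0$ with the order restriction $\sigma_1\le\sigma_2$. The entropy loss for estimating $\sigma^2$ by $\delta$ is $L_2(\delta,\sigma^2)=\delta/\sigma^2-\ln(\delta/\sigma^2)-1$;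 the risk of an estimator $\delta$ of $\sigma_2^2$ is $R(\delta)=E[L_2(\delta,\sigma_2^2)]$, a function of the parameters. The estimators to be improved are understood to have finite risk. An estimator $\delta'$ dominates $\delta$ if $R(\delta')\le R(\delta)$ for all admissible parameter values, with strict inequality for at least one. *)

(* Defs.v *)
From HB Require Import structures.
From mathcomp Require Import all_boot all_order all_algebra.
From mathcomp Require Import all_classical all_reals all_analysis.

Set Implicit Arguments.
Unset Strict Implicit.
Unset Printing Implicit Defensive.

Import Order.TTheory GRing.Theory Num.Theory.
Import numFieldNormedType.Exports.

Local Open Scope classical_set_scope.
Local Open Scope ring_scope.

(* The law N_n(theta, s^2 I) on R^n, as the iterated integral defining the
   product measure of the N(theta_i, s^2). As for [normal_prob], the scale
   parameter [s] is the standard deviation. *)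
Fixpoint mvnormal_prob (R : realType) (n : nat) :
    n.-tuple R -> R -> set (n.-tuple R) -> \bar R :=
  match n with
  | 0 => fun _ _ B => \d_[tuple] B
  | n.+1 => fun theta s B =>
      (\int[normal_prob (thead theta) s]_x
         mvnormal_prob [tuple of behead theta] s
           [set t : n.-tuple R | B [tuple of x :: t]])%E
  end.

Definition Gamma (R : realType) (a : R) : R :=
  \int[lebesgue_measure]_(x in `]0, +oo[) (x `^ (a - 1) * expR (- x)).

Definition chi2_pdf (R : realType) (m : nat) (x : R) : R :=
  if 0 < x then
    x `^ (m%:R / 2 - 1) * expR (- x / 2) / (2 `^ (m%:R / 2) * Gamma (m%:R / 2))
  else 0.

(* The law of c * Y where Y has the chi-square distribution with m degrees of
   freedom. *)
Definition scaled_chi2_prob (R : realType) (c : R) (m : nat) (C : set R) :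
    \bar R :=
  (\int[lebesgue_measure]_(y in [set y | C (c * y)%R]) (chi2_pdf m y)%:E)%E.

Record param (R : realType) (p q : nat) := Param {
  theta1 : p.-tuple R ;
  theta2 : q.-tuple R ;
  sigma1 : R ;
  sigma2 : R }.

Definition admissible (R : realType) (p q : nat) (pr : param R p q) : Prop :=
  [/\ 0 < sigma1 pr, 0 < sigma2 pr & sigma1 pr <= sigma2 pr].

Section model.
Context {R : realType} {d : measure_display} {T : measurableType d}.
Context {p q : nat}.

(* Under each admissible P pr, the variable tau has law Pi and, given tau = t,
   X1, S1, X2, S2 are independent with the stated laws: the product of these
   laws is a regular conditional distribution of (X1, S1, X2, S2) given tau. *)
Definition scale_mixture_model (m1 m2 : nat) (Pi : probability R R)
    (P : param R p q -> probability T R)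
    (tau : {mfun T >-> R}) (X1 : {mfun T >-> p.-tuple R})
    (S1 : {mfun T >-> R}) (X2 : {mfun T >-> q.-tuple R})
    (S2 : {mfun T >-> R}) : Prop :=
  forall pr, admissible pr ->
  forall (A : set R) (B1 : set (p.-tuple R)) (C1 : set R)
         (B2 : set (q.-tuple R)) (C2 : set R),
  measurable A -> measurable B1 -> measurable C1 ->
  measurable B2 -> measurable C2 ->
  P pr (tau @^-1` A `&` X1 @^-1` B1 `&` S1 @^-1` C1
          `&` X2 @^-1` B2 `&` S2 @^-1` C2) =
  (\int[Pi]_(t in A)
     (mvnormal_prob (theta1 pr) (sigma1 pr / Num.sqrt t)%R B1 *
      scaled_chi2_prob (sigma1 pr ^+ 2 / t)%R m1 C1 *
      mvnormal_prob (theta2 pr) (sigma2 pr / Num.sqrt t)%R B2 *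
      scaled_chi2_prob (sigma2 pr ^+ 2 / t)%R m2 C2))%E.

Definition entropy_loss (delta sigmasq : R) : R :=
  delta / sigmasq - ln (delta / sigmasq) - 1.

Definition risk (P : param R p q -> probability T R) (delta : T -> R)
    (pr : param R p q) : \bar R :=
  ('E_(P pr)[fun w => entropy_loss (delta w) (sigma2 pr ^+ 2)%R])%E.

Definition dominates (P : param R p q -> probability T R)
    (delta' delta : T -> R) : Prop :=
  (forall pr, admissible pr -> (risk P delta' pr <= risk P delta pr)%E) /\
  (exists pr, admissible pr /\ (risk P delta' pr < risk P delta pr)%E).

End model.

Definition psi11E (R : realType) (m1 m2 : nat) (Pi : probability R R) (z : R) :
    R :=
  (1 + z) / ((m1 + m2 + 2)%:R * fine ('E_Pi[fun t : R => (t^-1)%R])%E).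

(* Main.v *)
Require Import Defs.
From HB Require Import structures.
From mathcomp Require Import all_boot all_order all_algebra.
From mathcomp Require Import all_classical all_reals all_analysis.
From mathcomp Require Import measurable_realfun ring lra.
Import Order.TTheory GRing.Theory Num.Theory.
Import numFieldNormedType.Exports.
Local Open Scope classical_set_scope.
Local Open Scope ring_scope.

(** Put [x = psi1 / psi11E] on the event [A] where [psi1 < psi11E]. Pointwise, the
    loss of the new estimator plus [1_A (- ln x)] equals the old loss plus
    [1_A (1 - x) psi11E S2 / sigma2^2]. The conditional mean of [S2 / sigma2^2]
    given [S1 / S2] is at most [1 / psi11E], so the last term has expectation at
    most that of [1_A (1 - x)], and [1 - x < - ln x] on [A] gives the strict
    improvement.

    Given [tau], write [S1 = sigma1^2 U / tau] and [S2 = sigma2^2 V / tau] with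
    independent chi-square [U], [V]. The bound on the conditional mean reduces to
    [E[h(U / V) (U + V)] <= (m1 + m2 + 2) E[h(U / V)]]. Tilting the law of [(U, V)]
    by [exp(t (U + V))] only rescales both variables, which leaves [U / V]
    unchanged; integrating [1 + y <= exp y] against [h(U / V)] and choosing the
    tilt suitably gives the bound. *)

(** * Integrals restricted to a set of full measure *)

Section full_measure.
Context {d : measure_display} {T : measurableType d} {R : realType}.
Variables (mu : {measure set T -> \bar R}) (D : set T).
Hypotheses (mD : measurable D) (muDC : mu (~` D) = 0%E).
Import HBNNSimple.
Local Open Scope ereal_scope.

(** [psi1] is measurable on the positive half-line only, so a loss can be nonmeasurable as a
    function on the whole sample space. Cutting it down to an event of full measure precedes every
    measurability argument about it. *)
Lemma ge0_integral_full_measure (f : T -> \bar R) : (forall x, 0 <= f x) ->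
  \int[mu]_x f x = \int[mu]_(x in D) f x.
Proof.
move=> f0; have fD0 x : 0 <= (f \_ D) x by apply: erestrict_ge0.
apply/eqP; rewrite eq_le; apply/andP; split; last first.
  rewrite [leLHS]integral_mkcond !ge0_integralTE//.
  apply: ereal_sup_le => _ [h /= hf <-]; exists h => // x.
  apply: le_trans (hf x) _.
  by rewrite patchE; case: ifP.
rewrite [leLHS]ge0_integralTE//; apply: ge_ereal_sup => _ [h /= hf <-].
rewrite -integralT_nnsfun (@ge0_negligible_integral _ _ _ mu setT (~` D))//=.
- rewrite setTD setCK [leLHS]integral_mkcond [leRHS]integral_mkcond.
  pose hD := mul_nnsfun h (indic_nnsfun R mD).
  have hDE x : hD x = (h x * \1_D x)%R by [].
  have -> : (fun x => (h x)%:E) \_ D = EFin \o hD.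
    apply/funext => x; rewrite patchE [RHS](congr1 EFin (hDE x)) indicE.
    by case: ifP => _; rewrite ?mulr1 ?mulr0.
  rewrite integralT_nnsfun [leRHS]ge0_integralTE//.
  apply: ereal_sup_ubound => /=; exists hD => // x.
  rewrite hDE indicE patchE.
  by case: ifP => _; rewrite ?mulr1 ?mulr0.
- exact: measurableC.
- exact/measurable_EFinP.
- by move=> x _; rewrite lee_fin.
Qed.

(* The integral of a function, measurable or not, is built from the simple
   functions below it, and these may be cut down to [D]. *)
Lemma integral_full_measure (f : T -> \bar R) :
  \int[mu]_x f x = \int[mu]_(x in D) f x.
Proof. by rewrite integralE [RHS]integralE !ge0_integral_full_measure. Qed.

End full_measure.

(** * Integration against a measure with a density *)

Section density.
Context {d : measure_display} {T : measurableType d} {R : realType}.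
Variables (mu nu : {measure set T -> \bar R}) (f : T -> R).
Hypotheses (mf : measurable_fun setT f) (f0 : forall x, 0 <= f x).
Hypothesis nuE : forall A, measurable A ->
  nu A = (\int[mu]_(x in A) (f x)%:E)%E.
Import HBNNSimple.
Local Open Scope ereal_scope.

(** [nuE] is the claim for indicators; linearity carries it to simple functions, and monotone
    convergence to [g]. *)
Lemma ge0_integral_density (g : T -> \bar R) :
  measurable_fun setT g -> (forall x, 0 <= g x) ->
  \int[nu]_x g x = \int[mu]_x (g x * (f x)%:E).
Proof.
move=> mg g0.
pose g_ := nnsfun_approx measurableT mg.
have cvg_g x : (g_ n x)%:E @[n --> \oo] --> g x.
  by apply: cvg_nnsfun_approx.
transitivity (limn (fun n => \int[nu]_x (g_ n x)%:E)).
  rewrite -monotone_convergence//.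
  - by apply: eq_integral => x _; apply/esym/cvg_lim.
  - by move=> n; exact/measurable_EFinP.
  - by move=> n y _; rewrite lee_fin.
  - by move=> y _ m n mn; rewrite lee_fin; exact/lefP/nd_nnsfun_approx.
have mEf : measurable_fun setT (EFin \o f) by exact/measurable_EFinP.
rewrite [X in limn X](_ : _ = (fun n => \int[mu]_x ((g_ n x)%:E * (f x)%:E))).
  rewrite -monotone_convergence//; last 3 first.
  - by move=> n; apply: emeasurable_funM => //; exact/measurable_EFinP.
  - by move=> n x _; rewrite mule_ge0// lee_fin.
  - move=> y _ m n mn; rewrite lee_wpmul2r ?lee_fin//.
    exact/lefP/nd_nnsfun_approx.
  apply: eq_integral => x _; apply/cvg_lim => //.
  by apply: cvgeZr.
apply/funext => n.
transitivity (\sum_(k \in range (g_ n))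
    \int[mu]_x ((k * \1_(g_ n @^-1` [set k]) x)%:E * (f x)%:E)).
  under eq_integral do rewrite fimfunE -fsumEFin//.
  rewrite ge0_integral_fsum//; last 2 first.
  - by move=> y; exact/measurable_EFinP/measurable_funM.
  - by move=> y x _; rewrite nnfun_muleindic_ge0.
  apply: eq_fsbigr => r /[!inE] -[x _ rx].
  rewrite integralZl_indic_nnsfun// integral_indic//= setIT nuE//.
  under [RHS]eq_integral do rewrite EFinM -muleA.
  rewrite ge0_integralZl//; last 3 first.
  - by apply: emeasurable_funM => //; exact/measurable_EFinP.
  - by move=> y _; rewrite mule_ge0// lee_fin.
  - by rewrite lee_fin -rx.
  congr (_ * _); rewrite integral_mkcond; apply: eq_integral => y _.
  by rewrite patchE indicE; case: ifP; rewrite ?mul1e ?mul0e.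
rewrite -ge0_integral_fsum//.
- apply: eq_integral => x _; rewrite -ge0_mule_fsuml ?fsumEFin -?fimfunE// => r.
  by rewrite nnfun_muleindic_ge0.
- move=> r; apply: emeasurable_funM => //.
  by exact/measurable_EFinP/measurable_funM.
- by move=> r x _; rewrite mule_ge0 ?lee_fin// -lee_fin nnfun_muleindic_ge0.
Qed.

End density.

(** Turns a measurability proof into a bundled measure, to which uniqueness and transfer theorems
    apply; it still unfolds to [pushforward]. *)
Definition image_measure {d d' : measure_display} {T : measurableType d}
    {T' : measurableType d'} {R : realType} (mu : {measure set T -> \bar R})
    {f : T -> T'} (mf : measurable_fun setT f) : {measure set T' -> \bar R}.
Proof. unshelve refine (pushforward mu f); exact: mf. Defined.

(** * Lebesgue measure under dilations *)

Section lebesgue_scaling.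
Context {R : realType}.
Local Notation mu := (@lebesgue_measure R).
Local Open Scope ereal_scope.

(** The image of Lebesgue measure under [x -> c x], multiplied by [c], agrees with Lebesgue measure
    on half-open intervals, hence on all measurable sets. *)
Lemma ge0_integral_lebesgueM (c : R) (f : R -> \bar R) : (0 < c)%R ->
  measurable_fun setT f -> (forall x, 0 <= f x) ->
  c%:E * \int[mu]_x f (c * x)%R = \int[mu]_x f x.
Proof.
move=> c0 mf f0.
have mc : measurable_fun setT (fun x : R => (c * x)%R : measurableTypeR R).
  exact: measurable_funM.
pose nu := mscale (NngNum (ltW c0)) (image_measure mu mc).
transitivity (\int[nu]_x f x).
  by rewrite ge0_integral_mscale//= ge0_integral_pushforward.
apply: eq_measure_integral => /= A mA _; apply/esym.
apply: (@lebesgue_measure_unique _ nu _ _ mA) => _ [[a b] _ <-].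
rewrite -[RHS]/(c%:E * mu ((fun x => c * x)%R @^-1` `]a, b])).
rewrite (_ : _ @^-1` _ = `](a / c)%R, (b / c)%R]%classic); last first.
  by apply/seteqP; split => x/=;
    rewrite !in_itv/= ltr_pdivrMr// ler_pdivlMr// mulrC.
rewrite !lebesgue_measure_itv/= !lte_fin ltr_pM2r ?invr_gt0//.
case: ifP => _; last by rewrite mule0.
by rewrite -!EFinD -EFinM; congr EFin; rewrite mulrBr !(mulrC c) !divfK ?gt_eqF.
Qed.

End lebesgue_scaling.

(** On each half-line the inverse is a real power up to sign, and the convention [0^-1 = 0] fits the
    second branch. *)
Lemma measurable_inv {R : realType} : measurable_fun [set: R] (@GRing.inv R).
Proof.
have -> : @GRing.inv R =
    fun x => if 0 < x then x `^ (-1) else - ((- x) `^ (-1)).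
  apply/funext => x; case: ltP => x0; first by rewrite powR_inv1// ltW.
  by rewrite powR_inv1 ?oppr_ge0// invrN opprK.
apply: measurable_fun_ifT => //.
- exact: measurable_fun_ltr.
- apply: (measurableT_comp (@oppr_measurable R setT)).
  apply: (measurableT_comp (@measurable_powR R (-1))).
  exact: oppr_measurable.
Qed.

Lemma measurable_fun_div {d : measure_display} {T : measurableType d}
    {R : realType} (f g : T -> R) :
  measurable_fun setT f -> measurable_fun setT g ->
  measurable_fun setT (fun x => f x / g x).
Proof.
move=> mf mg; apply: measurable_funM => //.
exact: (measurableT_comp measurable_inv).
Qed.

(** * The chi-square law and its exponential tilts *)

Section chi2.
Context {R : realType}.
Local Notation mu := (@lebesgue_measure R).

Lemma Gamma_ge0 (a : R) : 0 <= Gamma a.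
Proof.
by apply: Rintegral_ge0 => x _; rewrite mulr_ge0 ?powR_ge0 ?expR_ge0.
Qed.

Lemma chi2_pdf_ge0 (m : nat) (x : R) : 0 <= chi2_pdf m x.
Proof.
rewrite /chi2_pdf; case: ifP => // _.
by rewrite divr_ge0 ?mulr_ge0 ?powR_ge0 ?expR_ge0 ?Gamma_ge0.
Qed.

Lemma measurable_chi2_pdf (m : nat) : measurable_fun [set: R] (chi2_pdf m).
Proof.
apply: measurable_fun_ifT => //; first exact: measurable_fun_ltr.
apply: measurable_funM => //; apply: measurable_funM => //.
apply: (measurableT_comp (@measurable_expR R)).
exact: measurable_funM.
Qed.

(** [exp((1 - 1/c) c x / 2) exp(- c x / 2) = exp(- x / 2)] explains the exponent, and the powers of
    [c] combine to [m / 2]. The absolute value agrees with its argument wherever the density is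
    nonzero; it makes the later weight [|u| + |v|] nonnegative on the whole plane. *)
Lemma chi2_pdfM (m : nat) (c x : R) : 0 < c ->
  c * (expR ((1 - c^-1) / 2 * `|c * x|) * chi2_pdf m (c * x)) =
  c `^ (m%:R / 2) * chi2_pdf m x.
Proof.
move=> c0; rewrite /chi2_pdf pmulr_rgt0//; case: ltP => x0; last first.
  by rewrite !mulr0.
rewrite gtr0_norm ?mulr_gt0// powRM ?ltW//.
rewrite (_ : c `^ (m%:R / 2) = c * c `^ (m%:R / 2 - 1)); last first.
  rewrite -{2}(powRr1 (ltW c0)) -powRD ?lt0r_neq0 ?implybT//.
  by congr (_ `^ _); ring.
have -> : expR (- x / 2) =
    expR ((1 - c^-1) / 2 * (c * x)) * expR (- (c * x) / 2).
  rewrite -expRD; congr expR; field; exact: lt0r_neq0.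
by rewrite -!mulrA; congr (_ * _); rewrite !mulrA; congr (_ / _); ring.
Qed.

(* Were the integral defining [Gamma] divergent, [Gamma] and hence [chi2_pdf] would
   be the junk value 0, so its convergence is not needed. *)
Lemma integral_chi2_pdf_lty (m : nat) :
  (\int[mu]_x (chi2_pdf m x)%:E < +oo)%E.
Proof.
set a : R := m%:R / 2.
have [G0|G0] := eqVneq (Gamma a) 0.
  rewrite (eq_integral (cst 0%E)) ?integral0// => x _.
  by rewrite /chi2_pdf -/a G0 mulr0 invr0 mulr0 if_same.
pose F (x : R) : \bar R :=
  (if 0 < x then x `^ (a - 1) * expR (- x) else 0)%:E.
have F0 x : (0 <= F x)%E.
  by rewrite lee_fin; case: ifP => // _; rewrite mulr_ge0 ?powR_ge0 ?expR_ge0.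
have mF : measurable_fun setT F.
  apply/measurable_EFinP; apply: measurable_fun_ifT => //.
    exact: measurable_fun_ltr.
  apply: measurable_funM; first exact: measurable_powR.
  exact: (measurableT_comp (@measurable_expR R)).
have Fy : (\int[mu]_x F x < +oo)%E.
  rewrite ltey; apply/eqP => FE; move: G0.
  rewrite /Gamma /Rintegral integral_mkcond.
  rewrite (_ : integral _ _ _ = +oo%E) ?eqxx//.
  rewrite -FE; apply: eq_integral => x _.
  by rewrite patchE /F mem_setE in_itv/= andbT; case: ifP.
(* The substitution [x = 2 y] turns the density into the Gamma integrand; [k] collects the
   constants. *)
pose k : R := 2 `^ (a - 1) / (2 `^ a * Gamma a).
have k0 : 0 <= k by rewrite divr_ge0 ?mulr_ge0 ?powR_ge0 ?Gamma_ge0.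
have pdfE (x : R) : (chi2_pdf m x)%:E = (k%:E * F (2^-1 * x)%R)%E.
  set y := 2^-1 * x; have -> : x = 2 * y by rewrite mulVKf.
  rewrite -EFinM /chi2_pdf -/a; congr EFin.
  rewrite pmulr_rgt0//; case: ltP => y0; last by rewrite mulr0.
  rewrite powRM ?ltW// /k (_ : - (2 * y) / 2 = - y); last by field.
  by rewrite -!mulrA; congr (_ * _); rewrite [RHS]mulrC -!mulrA.
under eq_integral do rewrite pdfE.
have mF2 : measurable_fun setT (fun x : R => F (2^-1 * x)).
  by apply: (measurableT_comp mF); exact: measurable_funM.
rewrite ge0_integralZl//; apply: lte_mul_pinfty => //.
have h2 : 0 < 2^-1 :> R by rewrite invr_gt0.
have /(_ h2) := @ge0_integral_lebesgueM R 2^-1 F _ mF F0.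
rewrite ltey => FE; apply/eqP => E; move: Fy.
by rewrite -FE E gt0_muley ?lte_fin ?ltxx.
Qed.

(** The unscaled law as a measure, ready for products and Tonelli; [scaled_chi2_prob c m] is its
    value on a preimage under [y -> c y]. *)
Definition chi2_prob (m : nat) (A : set R) : \bar R :=
  (\int[mu]_(x in A) (chi2_pdf m x)%:E)%E.

Section chi2_prob.
Variable m : nat.
Let mpdf : measurable_fun [set: R] (EFin \o @chi2_pdf R m).
Proof. by apply/measurable_EFinP; exact: measurable_chi2_pdf. Qed.

Let chi2_prob0 : chi2_prob m set0 = 0%E.
Proof. by rewrite /chi2_prob integral_set0. Qed.

Let chi2_prob_ge0 A : (0 <= chi2_prob m A)%E.
Proof. by apply: integral_ge0 => x _; rewrite lee_fin chi2_pdf_ge0. Qed.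

Let chi2_prob_sigma_additive : semi_sigma_additive (chi2_prob m).
Proof.
move=> /= F mF tF mUF; rewrite /chi2_prob; apply: cvg_toP.
  apply: ereal_nondecreasing_is_cvgn => i j ij.
  apply: lee_sum_nneg_natr => // k _ _; apply: integral_ge0 => /= x Fkx.
  by rewrite lee_fin chi2_pdf_ge0.
rewrite ge0_integral_bigcup//=.
- exact/measurable_funTS.
- by move=> x _; rewrite lee_fin chi2_pdf_ge0.
Qed.

HB.instance Definition _ := isMeasure.Build _ _ _
  (chi2_prob m) chi2_prob0 chi2_prob_ge0 chi2_prob_sigma_additive.

Let chi2_prob_fin : fin_num_fun (chi2_prob m).
Proof.
move=> A mA; rewrite ge0_fin_numE//.
apply: le_lt_trans (integral_chi2_pdf_lty m).
by apply: ge0_subset_integral => // x _; rewrite lee_fin chi2_pdf_ge0.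
Qed.

HB.instance Definition _ := @Measure_isFinite.Build _ _ _ (chi2_prob m)
  chi2_prob_fin.

Lemma integral_chi2_prob (g : R -> \bar R) :
  measurable_fun setT g -> (forall x, 0 <= g x)%E ->
  (\int[chi2_prob m]_x g x = \int[mu]_x (g x * (chi2_pdf m x)%:E))%E.
Proof.
move=> mg g0.
(* [lebesgue_measure] lives on [measurableTypeR R], [chi2_prob] on [R]; the image under the identity
   brings both to one space. *)
have mid : measurable_fun setT (idfun : measurableTypeR R -> R).
  by move=> _ A mA; rewrite setTI.
have muE (f : R -> \bar R) A : measurable A -> measurable_fun setT f ->
    (forall x, 0 <= f x)%E ->
    (\int[image_measure mu mid]_(x in A) f x = \int[mu]_(x in A) f x)%E.
  move=> mA mf f0; rewrite ge0_integral_pushforward//.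
  exact: measurable_funTS.
have pdf0 x : (0 <= (chi2_pdf m x)%:E :> \bar R)%E.
  by rewrite lee_fin chi2_pdf_ge0.
rewrite (@ge0_integral_density _ _ _ (image_measure mu mid) (chi2_prob m)
  (chi2_pdf m))//.
- by rewrite muE// => [|x]; [exact: emeasurable_funM|rewrite mule_ge0].
- exact: measurable_chi2_pdf.
- by move=> A mA; rewrite muE.
Qed.

(* Exponential tilting of a chi-square law is a change of scale. *)
Lemma integral_chi2_prob_tilt (c : R) (g : R -> \bar R) : 0 < c ->
  measurable_fun setT g -> (forall x, 0 <= g x)%E ->
  (\int[chi2_prob m]_x (g x * (expR ((1 - c^-1) / 2 * `|x|))%:E) =
   (c `^ (m%:R / 2))%:E * \int[chi2_prob m]_x g (c * x)%R)%E.
Proof.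
move=> c0 mg g0.
have mgc : measurable_fun setT (fun x : R => g (c * x)).
  by apply: (measurableT_comp mg); exact: measurable_funM.
have me : measurable_fun setT
    (fun x : R => (expR ((1 - c^-1) / 2 * `|x|))%:E).
  apply/measurable_EFinP; apply: (measurableT_comp (@measurable_expR R)).
  by apply: measurable_funM.
rewrite !integral_chi2_prob//; last 2 first.
- exact: emeasurable_funM.
- by move=> x; rewrite mule_ge0// lee_fin expR_ge0.
rewrite -ge0_integralZl//; last 3 first.
- exact: emeasurable_funM.
- by move=> x _; rewrite mule_ge0// lee_fin chi2_pdf_ge0.
- by rewrite lee_fin powR_ge0.
rewrite -(@ge0_integral_lebesgueM R c)//; last 2 first.
- by apply: emeasurable_funM => //; exact: emeasurable_funM.
- by move=> x; rewrite !mule_ge0// lee_fin ?chi2_pdf_ge0 ?expR_ge0.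
rewrite -ge0_integralZl//; last 3 first.
- apply: (measurableT_comp (f := fun x : R =>
    (g x * (expR ((1 - c^-1) / 2 * `|x|))%:E * (chi2_pdf m x)%:E)%E)).
    by apply: emeasurable_funM => //; exact: emeasurable_funM.
  exact: measurable_funM.
- by move=> x _; rewrite !mule_ge0// lee_fin ?chi2_pdf_ge0 ?expR_ge0.
- by rewrite lee_fin ltW.
apply: eq_integral => x _.
rewrite -!muleA -EFinM muleCA -EFinM chi2_pdfM// [RHS]muleCA.
by rewrite -EFinM.
Qed.

End chi2_prob.

End chi2.

(* The witness [c = (a + 1) ^ 2 / (a * (a + 2))] makes [1 - c^-1 = (a + 1) ^- 2]. *)
Lemma powR_sub1_le {R : realType} (a : R) : 0 < a ->
  exists2 c : R, 1 < c & c `^ a - 1 <= (a + 1) * (1 - c^-1).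
Proof.
move=> a0; pose e : R := (a * (a + 2))^-1.
have e0 : 0 < e by rewrite invr_gt0 mulr_gt0 ?addr_gt0.
exists (1 + e); first by rewrite ltrDl.
have a2 : a + 2 != 0 by rewrite gt_eqF ?addr_gt0.
have a1 : a + 1 != 0 by rewrite gt_eqF ?addr_gt0.
have an0 : a != 0 by rewrite gt_eqF.
have -> : (a + 1) * (1 - (1 + e)^-1) = (a + 1)^-1.
  have -> : 1 + e = (a + 1) ^+ 2 / (a * (a + 2)).
    by rewrite /e; field; apply/andP.
  by rewrite invf_div; field.
have aeE : a * e = (a + 2)^-1 by rewrite /e; field; apply/andP.
have ae1 : 0 < 1 - a * e.
  by rewrite aeE subr_gt0 invf_lt1 ?addr_gt0//; lra.
(* [ln (1 + e) <= e] bounds the power by [expR (a * e)], and [expR (- (a * e)) >= 1 - a * e] bounds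
   that by the inverse. For this [e], [(1 - a * e)^-1] equals [1 + (a + 1)^-1] exactly. *)
have : (1 + e) `^ a <= (1 - a * e)^-1.
  rewrite /powR gt_eqF ?addr_gt0//.
  apply: (@le_trans _ _ (expR (a * e))).
    by rewrite ler_expR ler_pM2l// le_ln1Dx// (lt_trans _ e0)// ltrN10.
  rewrite -[leLHS]invrK lef_pV2 ?posrE ?invr_gt0 ?expR_gt0// -expRN.
  exact: expR_ge1Dx.
rewrite lerBlDr => /le_trans; apply; rewrite aeE.
have -> : 1 - (a + 2)^-1 = (a + 1) / (a + 2) by field.
by rewrite invf_div le_eqVlt; apply/orP; left; apply/eqP; field.
Qed.

(** * The ratio of two independent chi-square variables *)

Section chi2_ratio.
Context {R : realType} (m1 m2 : nat).
Local Notation Q := (chi2_prob m1 \x chi2_prob m2)%E.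
Variable h : R -> R.
Hypotheses (mh : measurable_fun setT h) (h0 : forall x, 0 <= h x).

Lemma measurable_ratio : measurable_fun setT (fun z : R * R => h (z.1 / z.2)).
Proof. by apply: (measurableT_comp mh); exact: measurable_fun_div. Qed.

(** Tonelli lets the one-variable tilt act on each coordinate in turn, each contributing its own
    power of [c]; the two dilations then cancel in [u / v]. *)
Lemma integral_chi2_ratio_tilt (c : R) : 0 < c ->
  (\int[Q]_z (h (z.1 / z.2) * (expR ((1 - c^-1) / 2 * `|z.1|) *
                               expR ((1 - c^-1) / 2 * `|z.2|)))%:E =
   (c `^ ((m1 + m2)%:R / 2))%:E * \int[Q]_z (h (z.1 / z.2))%:E)%E.
Proof.
move=> c0; pose e (x : R) := expR ((1 - c^-1) / 2 * `|x|).
have me : measurable_fun setT e.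
  apply: (measurableT_comp (@measurable_expR R)); exact: measurable_funM.
have mH := measurable_ratio.
rewrite fubini_tonelli1; last 2 first.
- apply/measurable_EFinP; apply: measurable_funM => //.
  by apply: measurable_funM; apply: (measurableT_comp me).
- by move=> z; rewrite lee_fin !mulr_ge0 ?expR_ge0.
rewrite [in RHS]fubini_tonelli1; last 2 first.
- exact/measurable_EFinP.
- by move=> z; rewrite lee_fin.
(* In [k] only the second coordinate has been rescaled; rescaling the first one later restores the
   ratio. *)
pose k (u : R) : \bar R := (\int[chi2_prob m2]_v (h (u / (c * v)))%:E)%E.
have k0 u : (0 <= k u)%E by apply: integral_ge0 => v _; rewrite lee_fin.
have mHc : measurable_fun setT (fun z : R * R => (h (z.1 / (c * z.2)))%:E).
  apply/measurable_EFinP; apply: (measurableT_comp mh).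
  by apply: measurable_fun_div => //; exact: measurable_funM.
have mk : measurable_fun setT k.
  apply: (@measurable_fun_fubini_tonelli_F _ _ _ _ _ (chi2_prob m2) _ mHc).
  by move=> z; rewrite lee_fin.
have mhu (u : R) : measurable_fun setT (fun v : R => (h (u / v))%:E).
  apply/measurable_EFinP; apply: (measurableT_comp mh).
  exact: measurable_fun_div.
have inner (u : R) :
    (\int[chi2_prob m2]_v (h (u / v) * (e u * e v))%:E =
     (c `^ (m2%:R / 2))%:E * (k u * (e u)%:E))%E.
  under eq_integral do rewrite mulrCA EFinM (EFinM (h _)).
  rewrite ge0_integralZl//.
  - rewrite (@integral_chi2_prob_tilt _ m2 c (fun v => (h (u / v))%:E))//;
      last by move=> v; rewrite lee_fin.
    by rewrite -/(k u) muleCA (muleC (e u)%:E).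
  - by apply: emeasurable_funM => //; exact/measurable_EFinP.
  - by move=> v _; rewrite mule_ge0// lee_fin ?expR_ge0.
  - by rewrite lee_fin expR_ge0.
rewrite (eq_integral _ _ (fun u _ => inner u)).
rewrite ge0_integralZl//; last 3 first.
- by apply: emeasurable_funM => //; exact/measurable_EFinP.
- by move=> v _; rewrite mule_ge0// lee_fin ?expR_ge0.
- by rewrite lee_fin powR_ge0.
rewrite integral_chi2_prob_tilt// muleA -EFinM -powRD; last first.
  by rewrite lt0r_neq0 ?implybT.
rewrite natrD mulrDl addrC; congr (_ * _)%E.
apply: eq_integral => u _; rewrite /k /fubini_F/=; apply: eq_integral => v _.
by rewrite -mulf_div divff ?lt0r_neq0// mul1r.
Qed.

Hypothesis h1 : forall x, h x <= 1.

(* Integrating [1 + t <= expR t] brings in the tilted law, under which the ratio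
   keeps its distribution. *)
Lemma integral_chi2_ratioM_le : (0 < m1)%N ->
  (\int[Q]_z (h (z.1 / z.2) * (`|z.1| + `|z.2|))%:E <=
   (m1 + m2 + 2)%:R%:E * \int[Q]_z (h (z.1 / z.2))%:E)%E.
Proof.
move=> m1_gt0; pose a : R := (m1 + m2)%:R / 2.
have a0 : 0 < a by rewrite divr_gt0// ltr0n addn_gt0 m1_gt0.
have [c c1 ca] := powR_sub1_le _ a0.
have c0 : 0 < c by rewrite (lt_trans ltr01).
pose d : R := (1 - c^-1) / 2.
have d0 : 0 < d by rewrite divr_gt0// subr_gt0 invf_lt1.
have mH := measurable_ratio.
have mN : measurable_fun setT (fun z : R * R => `|z.1| + `|z.2|).
  by apply: measurable_funD; exact: measurableT_comp.
have me1 : measurable_fun setT (fun z : R * R => expR (d * `|z.1|)).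
  apply: (measurableT_comp (@measurable_expR R)).
  by apply: measurable_funM => //; exact: measurableT_comp.
have me2 : measurable_fun setT (fun z : R * R => expR (d * `|z.2|)).
  apply: (measurableT_comp (@measurable_expR R)).
  by apply: measurable_funM => //; exact: measurableT_comp.
set I := (\int[Q]_z (h (z.1 / z.2))%:E)%E.
set J := (\int[Q]_z (h (z.1 / z.2) * (`|z.1| + `|z.2|))%:E)%E.
have I0 : (0 <= I)%E by apply: integral_ge0 => z _; rewrite lee_fin.
have J0 : (0 <= J)%E.
  by apply: integral_ge0 => z _; rewrite lee_fin mulr_ge0// addr_ge0.
(* Finite because [h <= 1] and both measures are finite, so a multiple of [I] can be subtracted
   below. *)
have Ify : I \is a fin_num.
  rewrite ge0_fin_numE//; apply: (@le_lt_trans _ _ (\int[Q]_z 1)%E).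
    apply: ge0_le_integral => //.
    - by move=> z _; rewrite lee_fin.
    - exact/measurable_EFinP.
    - by move=> z _; rewrite lee_fin.
  rewrite integral_cst// mul1e -setXTT [ltLHS]product_measure1E//.
  by rewrite lte_mul_pinfty ?measure_ge0 ?fin_num_measure// -ge0_fin_numE
    ?measure_ge0 ?fin_num_measure.
have IJ : (I + d%:E * J <= (c `^ a)%:E * I)%E.
  rewrite -integral_chi2_ratio_tilt// -/d -ge0_integralZl//; last 3 first.
  - by apply/measurable_EFinP; apply: measurable_funM.
  - by move=> z _; rewrite lee_fin mulr_ge0// addr_ge0.
  - by rewrite lee_fin ltW.
  rewrite -ge0_integralD//; last 4 first.
  - by move=> z _; rewrite lee_fin.
  - exact/measurable_EFinP.
  - move=> z _; rewrite -EFinM lee_fin; apply: mulr_ge0; first exact: ltW.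
    by apply: mulr_ge0 => //; exact: addr_ge0.
  - apply/measurable_EFinP; apply: measurable_funM => //.
    exact: measurable_funM.
  apply: ge0_le_integral => //.
  - move=> z _; rewrite -EFinM -EFinD lee_fin; apply: addr_ge0 => //.
    apply: mulr_ge0; first exact: ltW.
    by apply: mulr_ge0 => //; exact: addr_ge0.
  - apply/measurable_EFinP; apply: measurable_funD => //.
    by apply: measurable_funM => //; exact: measurable_funM.
  - apply/measurable_EFinP; apply: measurable_funM => //.
    exact: measurable_funM.
  - move=> z _; rewrite -EFinM -EFinD lee_fin -expRD mulrCA -mulrDr.
    rewrite -{1}[h _]mulr1 -mulrDr ler_wpM2l//; exact: expR_ge1Dx.
move: IJ; rewrite -(fineK Ify); set x := fine I.
have x0 : 0 <= x by exact: fine_ge0.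
(* An infinite [J] would contradict [IJ], whose right-hand side is finite and whose coefficient [d]
   is positive. *)
case: J J0 => [y| |]//= y0; last first.
  by rewrite gt0_muley ?lte_fin// addey// -EFinM leye_eq.
rewrite -!EFinM -EFinD !lee_fin => IJ.
rewrite -(ler_pM2l d0).
(* [2 d = 1 - 1/c] and [2 (a + 1) = m1 + m2 + 2]: this is the source of the constant in [psi11E]. *)
have -> : d * ((m1 + m2 + 2)%:R * x) = (a + 1) * (1 - c^-1) * x.
  by rewrite /d /a [in LHS]natrD; field; exact: lt0r_neq0.
apply: (@le_trans _ _ ((c `^ a - 1) * x)); last exact: ler_wpM2r.
by rewrite mulrBl mul1r lerBrDl.
Qed.

End chi2_ratio.

(** Serves to integrate [X1] and [X2] out of the model. *)
Lemma mvnormal_prob_setT {R : realType} (n : nat) (theta : n.-tuple R) (s : R) :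
  mvnormal_prob theta s setT = 1%E.
Proof.
elim: n theta => [theta|n IHn theta] /=; first by rewrite diracT.
under eq_integral => x _ do rewrite (_ : [set _ | _] = setT) ?IHn//.
by rewrite integral_cst// mul1e; exact: integral_normal_pdf.
Qed.

Section chi2_pair.
Context {R : realType} (m1 m2 : nat).

(** A name for the product to which finiteness is attached, so that Tonelli applies to its product
    with [Pi]. *)
Definition chi2_pair : set (R * R) -> \bar R :=
  (@chi2_prob R m1 \x @chi2_prob R m2)%E.

HB.instance Definition _ := Measure.on chi2_pair.

Let chi2_pair_fin : fin_num_fun chi2_pair.
Proof.
move=> A mA; rewrite ge0_fin_numE//.
apply: (@le_lt_trans _ _ (chi2_pair setT)); first by rewrite le_measure ?inE.
rewrite -setXTT [ltLHS]product_measure1E//.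
by rewrite lte_mul_pinfty ?fin_num_measure// -ge0_fin_numE ?fin_num_measure.
Qed.

HB.instance Definition _ := @Measure_isFinite.Build _ _ _ chi2_pair
  chi2_pair_fin.

End chi2_pair.

(** * The joint law of the two scale statistics *)

Section law.
Context {R : realType} {d : measure_display} {T : measurableType d}.
Context {p q : nat} {m1 m2 : nat} {Pi : probability R R}.
Context {P : param R p q -> probability T R} {tau : {mfun T >-> R}}.
Context {X1 : {mfun T >-> p.-tuple R}} {S1 : {mfun T >-> R}}.
Context {X2 : {mfun T >-> q.-tuple R}} {S2 : {mfun T >-> R}}.
Hypothesis model : scale_mixture_model m1 m2 Pi P tau X1 S1 X2 S2.
Variable pr : param R p q.
Hypothesis pr_adm : admissible pr.
Local Notation Q := (chi2_pair m1 m2).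

Let S (w : T) : R * R := (S1 w, S2 w).
Let mS : measurable_fun setT S.
Proof. by apply: measurable_fun_pair. Qed.

(** Rebuilds a value of [(S1, S2)] from a value of [tau] and a pair of unscaled chi-square
    values. *)
Let G (z : R * (R * R)) : R * R :=
  (sigma1 pr ^+ 2 / z.1 * z.2.1, sigma2 pr ^+ 2 / z.1 * z.2.2).
Let mG : measurable_fun setT G.
Proof.
apply: measurable_fun_pair; apply: measurable_funM.
- by apply: measurable_fun_div.
- by apply: (measurableT_comp (f := fst)).
- by apply: measurable_fun_div.
- by apply: (measurableT_comp (f := snd)).
Qed.

Let rho : {measure set (R * (R * R))%type -> \bar R} :=
  (Pi \x @chi2_pair R m1 m2)%E.

(** The model is applied with full sets for [tau], [X1] and [X2]; the two factors that remain are
    the [chi2_pair] measure of a section. *)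
Let law_rectangle (C1 C2 : set R) : measurable C1 -> measurable C2 ->
  P pr (S @^-1` (C1 `*` C2)) = rho (G @^-1` (C1 `*` C2)).
Proof.
move=> mC1 mC2.
have := model pr pr_adm setT setT C1 setT C2 measurableT measurableT mC1
  measurableT mC2.
rewrite !preimage_setT !setTI setIT => ->.
apply: eq_integral => t _; rewrite !mvnormal_prob_setT mul1e mule1.
have mM (c : R) (C : set R) : measurable C -> measurable [set y | C (c * y)].
  move=> mC; have mc : measurable_fun setT (fun y : R => c * y).
    exact: measurable_funM.
  by rewrite -[X in measurable X]setTI; exact: mc.
rewrite /= (_ : xsection _ _ = [set y | C1 (sigma1 pr ^+ 2 / t * y)] `*`
    [set y | C2 (sigma2 pr ^+ 2 / t * y)]); last first.
  by apply/seteqP; split => z; rewrite /xsection/= inE.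
by apply/esym/product_measure1E; exact: mM.
Qed.

(** Rectangles are stable under intersection and generate the product sigma-algebra, so
    [law_rectangle] determines the law. *)
Lemma measure_law (E : set (R * R)) : measurable E ->
  P pr (S @^-1` E) = rho (G @^-1` E).
Proof.
pose C := [set C : set (R * R) |
  exists A, measurable A /\ exists B, measurable B /\ C = A `*` B].
move=> mE.
suff : image_measure (P pr) mS E = image_measure rho mG E by [].
apply: (measure_unique C (fun=> setT)) => //.
- rewrite measurable_prod_measurableType //; congr (<<s _ >>).
  rewrite predeqE; split => [[A mA [B mB <-]]|[A [mA [B [mB ->]]]]].
    by exists A; split => //; exists B.
  by exists A => //; exists B.
- move=> /= _ _ [A1 [mA1 [A2 [mA2 ->]]]] [B1 [mB1 [B2 [mB2 ->]]]].
  rewrite -setXI; exists (A1 `&` B1); split; first exact: measurableI.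
  by exists (A2 `&` B2); split => //; exact: measurableI.
- move=> _; exists setT; split => //; exists setT; split => //.
  by rewrite setXTT.
- by rewrite bigcup_const.
- by move=> _ [A [mA [B [mB ->]]]]; exact: law_rectangle.
- by move=> _; rewrite /= /pushforward preimage_setT probability_setT ltry.
Qed.

Lemma integral_law (k : R * R -> \bar R) : measurable_fun setT k ->
  (forall z, 0 <= k z)%E ->
  (\int[P pr]_w k (S1 w, S2 w) =
   \int[Pi]_t \int[Q]_z
     k (sigma1 pr ^+ 2 / t * z.1, sigma2 pr ^+ 2 / t * z.2)%R)%E.
Proof.
move=> mk k0.
transitivity (\int[image_measure (P pr) mS]_z k z)%E.
  by rewrite ge0_integral_pushforward.
transitivity (\int[image_measure rho mG]_z k z)%E.
  by apply: eq_measure_integral => A mA _; exact: measure_law.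
rewrite ge0_integral_pushforward// preimage_setT fubini_tonelli1//.
  exact: measurableT_comp.
by move=> z; exact: k0.
Qed.

End law.

(** A zero integral would force [f = 0] almost everywhere on [D], and positivity of [f] would then
    make [D] null. *)
Lemma integral_gt0 {d : measure_display} {T : measurableType d} {R : realType}
    (mu : {measure set T -> \bar R}) (D : set T) (f : T -> \bar R) :
  measurable D -> measurable_fun D f -> (forall x, D x -> 0 < f x)%E ->
  (0 < mu D)%E -> (0 < \int[mu]_(x in D) f x)%E.
Proof.
move=> mD mf f0 D0.
have If0 : (0 <= \int[mu]_(x in D) f x)%E.
  by apply: integral_ge0 => x Dx; exact/ltW/f0.
rewrite lt_neqAle If0 andbT; apply/eqP => fE; move: D0.
have /(ae_eq_integral_abs mu mD mf) [N [mN N0 DN]] :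
    (\int[mu]_(x in D) `|f x| = 0)%E.
  by rewrite fE; apply: eq_integral => x /[!inE] Dx; rewrite gee0_abs// ltW ?f0.
rewrite lt0e => /andP[/negP + _]; apply; apply/eqP.
apply: (@measure_negligible _ _ _ mu D mD); exists N; split => // x Dx.
by apply: DN => /= /(_ Dx) E; have := f0 x Dx; rewrite E ltxx.
Qed.

Lemma lt_ln_sub1 {R : realType} (x : R) : 0 < x -> x != 1 -> ln x < x - 1.
Proof.
move=> x0 x1; rewrite ltrBrDl -[ltRHS](@lnK R)//; apply: expR_gt1Dx.
by rewrite ln_eq0.
Qed.

Lemma le_ln_sub1 {R : realType} (x : R) : 0 < x -> ln x <= x - 1.
Proof.
move=> x0; have [->|x1] := eqVneq x 1; first by rewrite ln1 subrr.
exact/ltW/lt_ln_sub1.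
Qed.

(** * The inverse moment of the mixing variable *)

Section mixing_moment.
Context {R : realType} {Pi : probability R R}.
Hypothesis Pi_pos : Pi `]0, +oo[%classic = 1%E.

Lemma integral_mixing_pos (f : R -> \bar R) :
  (\int[Pi]_t f t = \int[Pi]_(t in `]0%R, +oo[) f t)%E.
Proof.
apply: integral_full_measure => //.
by rewrite [LHS](@probability_setC _ _ _ Pi)// Pi_pos subee.
Qed.

Hypothesis Pi_inv_fin : ('E_Pi[fun t : R => (t^-1)%R])%E \is a fin_num.
Local Notation E1 := (fine 'E_Pi[fun t : R => (t^-1)%R]%E).

Lemma integral_mixing_inv : (\int[Pi]_(t in `]0%R, +oo[) (t^-1)%:E = E1%:E)%E.
Proof. by rewrite fineK// unlock -integral_mixing_pos. Qed.

(** Makes the denominator of [psi11E] positive. *)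
Lemma mixing_inv_gt0 : 0 < E1.
Proof.
rewrite -lte_fin -integral_mixing_inv; apply: integral_gt0 => //.
- by apply/measurable_EFinP/measurable_funTS; exact: measurable_inv.
- by move=> t; rewrite /= in_itv/= andbT lte_fin invr_gt0.
- by rewrite [ltRHS]Pi_pos.
Qed.

End mixing_moment.

Lemma chi2_prob_le0 {R : realType} (m : nat) :
  chi2_prob m `]-oo, 0%R : R] = 0%E.
Proof.
by apply: integral0_eq => x; rewrite /= in_itv/= /chi2_pdf ltNge => ->.
Qed.

(** * The conditional mean bound under the scale mixture *)

Section scale_mixture.
Context {R : realType} {d : measure_display} {T : measurableType d}.
Context {p q : nat} {m1 m2 : nat} {Pi : probability R R}.
Context {P : param R p q -> probability T R} {tau : {mfun T >-> R}}.
Context {X1 : {mfun T >-> p.-tuple R}} {S1 : {mfun T >-> R}}.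
Context {X2 : {mfun T >-> q.-tuple R}} {S2 : {mfun T >-> R}}.
Hypothesis model : scale_mixture_model m1 m2 Pi P tau X1 S1 X2 S2.
Hypothesis m1_gt0 : (0 < m1)%N.
Hypothesis Pi_pos : Pi `]0, +oo[%classic = 1%E.
Hypothesis Pi_inv_fin : ('E_Pi[fun t : R => (t^-1)%R])%E \is a fin_num.
Variable pr : param R p q.
Hypothesis pr_adm : admissible pr.
Local Notation Q := (chi2_pair m1 m2).
Local Notation s1 := (sigma1 pr).
Local Notation s2 := (sigma2 pr).

Let s1_gt0 : 0 < s1 ^+ 2. Proof. by case: pr_adm => *; exact: exprn_gt0. Qed.
Let s2_gt0 : 0 < s2 ^+ 2. Proof. by case: pr_adm => *; exact: exprn_gt0. Qed.

(** On this event the ratio lies in the domain of [psi1], and every logarithm in the losses has a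
    positive argument. *)
Definition positive_scales : set T := [set w | 0 < S1 w /\ 0 < S2 w].

Lemma measurable_positive_scales : measurable positive_scales.
Proof.
rewrite (_ : positive_scales =
  S1 @^-1` `]0, +oo[ `&` S2 @^-1` `]0, +oo[); last first.
  by apply/seteqP; split => w/=; rewrite !in_itv/= !andbT.
by apply: measurableI; rewrite -[X in measurable X]setTI;
  exact: measurable_funP.
Qed.

(** For [t > 0] the scale factors are positive and preserve signs, and chi-square measures give no
    mass to the nonpositive half-line. *)
Lemma positive_scales_full : P pr (~` positive_scales) = 0%E.
Proof.
pose Pos : set (R * R) := `]0, +oo[ `*` `]0, +oo[.
have mPos : measurable (~` Pos) by apply: measurableC; exact: measurableX.
rewrite (_ : ~` _ = (fun w => (S1 w, S2 w)) @^-1` (~` Pos)); last first.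
  rewrite -preimage_setC; congr (~` _).
  by apply/seteqP; split => w/=; rewrite /Pos/= !in_itv/= !andbT.
rewrite (measure_law model pr pr_adm)//= /product_measure1.
rewrite (integral_mixing_pos Pi_pos).
apply: integral0_eq => t; rewrite /= in_itv/= andbT => t0.
have c1 : 0 < s1 ^+ 2 / t by exact: divr_gt0.
have c2 : 0 < s2 ^+ 2 / t by exact: divr_gt0.
set E := xsection _ _.
have -> : E = ~` Pos.
  apply/seteqP; split => -[u v]; rewrite /E /xsection /Pos /= inE/= !in_itv/=.
    by rewrite !andbT (pmulr_rgt0 _ c1) (pmulr_rgt0 _ c2).
  by rewrite !andbT (pmulr_rgt0 _ c1) (pmulr_rgt0 _ c2).
apply/eqP; rewrite -measure_le0.
have -> : ~` Pos = (`]-oo, 0] `*` setT) `|` (setT `*` `]-oo, 0]).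
  rewrite /Pos; apply/seteqP; split => -[u v]/=; rewrite !in_itv/= !andbT.
    case: (ltP 0 u) => u0; case: (ltP 0 v) => v0 H; try by [left|right].
    by exfalso; exact: H.
  by case: (ltP 0 u) => u0; case: (ltP 0 v) => v0 => -[[]|[]]// _ _ [].
apply: le_trans (measureU2 _ _ _) _; [exact: measurableX..|].
rewrite ![X in (X + _ <= _)%E]product_measure1E//.
rewrite ![X in (_ + X <= _)%E]product_measure1E//.
by rewrite /= !chi2_prob_le0 mule0 mul0e adde0.
Qed.

Section weighted.
Variable g : R -> R.
Hypotheses (mg : measurable_fun setT g) (g0 : forall z, 0 <= g z).
Hypotheses (g1 : forall z, g z <= 1) (g_pos : forall z, z <= 0 -> g z = 0).

(* [E[S2 / sigma2^2 | S1 / S2 = z]] is at most [1 / psi11E z]. *)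
Lemma expectation_psi11E_le :
  (\int[P pr]_w (g (S1 w / S2 w) *
      (psi11E m1 m2 Pi (S1 w / S2 w) * (`|S2 w| / s2 ^+ 2)))%:E <=
   \int[P pr]_w (g (S1 w / S2 w))%:E)%E.
Proof.
have E1_gt0 := mixing_inv_gt0 Pi_pos Pi_inv_fin.
have IE1 := integral_mixing_inv Pi_pos Pi_inv_fin.
pose M : R := (m1 + m2 + 2)%:R.
have M_gt0 : 0 < M by rewrite ltr0n addnS.
have psiE z : psi11E m1 m2 Pi z =
    (1 + z) / (M * fine ('E_Pi[fun t : R => (t^-1)%R])%E) by [].
move: E1_gt0 IE1 psiE; set E1 := fine _ => E1_gt0 IE1 psiE.
have psi_gt0 z : 0 < z -> 0 < psi11E m1 m2 Pi z.
  by move=> z0; rewrite psiE divr_gt0 ?mulr_gt0 ?addr_gt0.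
have mpsi : measurable_fun setT (psi11E m1 m2 Pi).
  by apply: measurable_funM => //; exact: measurable_funD.
have mdiv : measurable_fun setT (fun z : R * R => z.1 / z.2).
  exact: measurable_fun_div.
have gpsi0 z b : 0 <= b -> 0 <= g z * (psi11E m1 m2 Pi z * b).
  move=> b0; have [z0|z0] := leP z 0; first by rewrite g_pos ?mul0r.
  by apply: mulr_ge0 => //; apply: mulr_ge0 => //; exact/ltW/psi_gt0.
pose k (z : R * R) : \bar R := (g (z.1 / z.2) *
  (psi11E m1 m2 Pi (z.1 / z.2) * (`|z.2| / s2 ^+ 2)))%:E.
have mk : measurable_fun setT k.
  apply/measurable_EFinP; apply: measurable_funM.
    exact: (measurableT_comp mg).
  apply: measurable_funM; first exact: (measurableT_comp mpsi).
  by apply: measurable_funM => //; exact: measurableT_comp.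
have k0 z : (0 <= k z)%E by rewrite lee_fin gpsi0// divr_ge0// ltW.
pose k' (z : R * R) : \bar R := (g (z.1 / z.2))%:E.
have mk' : measurable_fun setT k'.
  by apply/measurable_EFinP; exact: (measurableT_comp mg).
have k'0 z : (0 <= k' z)%E by rewrite lee_fin.
rewrite [leLHS](integral_law model pr pr_adm k mk k0).
rewrite [leRHS](integral_law model pr pr_adm k' mk' k'0).
rewrite !(integral_mixing_pos Pi_pos).
pose rho : R := s1 ^+ 2 / s2 ^+ 2.
have rho0 : 0 < rho by exact: divr_gt0.
(* The order restriction [sigma1 <= sigma2] enters here. *)
have rho1 : rho <= 1.
  case: pr_adm => a b ab; rewrite ler_pdivrMr// mul1r.
  by rewrite ler_pXn2r// nnegrE ltW.
(* Since [S1 / S2 = rho U / V], the weight becomes a function of [U / V], free of [t]. *)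
pose h (x : R) := g (rho * x).
have mh : measurable_fun setT h.
  by apply: (measurableT_comp mg); exact: measurable_funM.
have ratioE (t : R) (z : R * R) : 0 < t ->
    (s1 ^+ 2 / t * z.1) / (s2 ^+ 2 / t * z.2) = rho * (z.1 / z.2).
  move=> t0; rewrite -mulf_div; congr (_ * _).
  by rewrite /rho invf_div mulrA divfK ?gt_eqF.
pose K := (\int[Q]_z (h (z.1 / z.2))%:E)%E.
have -> : (\int[Pi]_(t in `]0%R, +oo[) \int[Q]_z
     k' (s1 ^+ 2 / t * z.1, s2 ^+ 2 / t * z.2)%R = K)%E.
  rewrite (eq_integral (cst K)).
    by rewrite integral_cst// [X in (_ * X)%E]Pi_pos mule1.
  move=> t; rewrite inE/= in_itv/= andbT => t0.
  by apply: eq_integral => z _; rewrite /k'/= ratioE.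
pose b (z : R * R) : R :=
  h (z.1 / z.2) * (psi11E m1 m2 Pi (rho * (z.1 / z.2)) * `|z.2|).
have mb : measurable_fun setT (EFin \o b).
  apply/measurable_EFinP; apply: measurable_funM.
    exact: (measurableT_comp mh).
  apply: measurable_funM; last exact: measurableT_comp.
  by apply: (measurableT_comp mpsi); exact: measurable_funM.
have b0 z : (0 <= (b z)%:E)%E by rewrite lee_fin gpsi0.
(* The factor [1 / t] in [S2 / sigma2^2 = V / t] leaves the inner integral and integrates to
   [E1]. *)
have -> : (\int[Pi]_(t in `]0%R, +oo[) \int[Q]_z
     k (s1 ^+ 2 / t * z.1, s2 ^+ 2 / t * z.2)%R = E1%:E * \int[Q]_z (b z)%:E)%E.
  rewrite -IE1 -ge0_integralZr//; last 3 first.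
  - by apply/measurable_EFinP/measurable_funTS; exact: measurable_inv.
  - by move=> t; rewrite /= in_itv/= andbT => t0; rewrite lee_fin invr_ge0 ltW.
  - exact: integral_ge0.
  apply: eq_integral => t; rewrite inE/= in_itv/= andbT => t0.
  rewrite -ge0_integralZl//; last by rewrite lee_fin invr_ge0 ltW.
  apply: eq_integral => z _; rewrite /k /= ratioE// -EFinM; congr EFin.
  rewrite /b [RHS]mulrCA; congr (_ * _); rewrite [RHS]mulrCA; congr (_ * _).
  rewrite normrM gtr0_norm ?divr_gt0// [LHS]mulrAC; congr (_ * _).
  by rewrite mulrAC divff ?mul1r// gt_eqF.
have mN : measurable_fun setT
    (fun z : R * R => h (z.1 / z.2) * (`|z.1| + `|z.2|)).
  apply: measurable_funM; first exact: (measurableT_comp mh).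
  by apply: measurable_funD; exact: measurableT_comp.
(* [E1] cancels against the one inside [psi11E], which leaves the factor [M^-1]; the chi-square
   bound then absorbs it. *)
apply: (@le_trans _ _ (M^-1%:E * \int[Q]_z
    (h (z.1 / z.2) * (`|z.1| + `|z.2|))%:E)%E); last first.
  apply: (@le_trans _ _ (M^-1%:E * (M%:E * K))%E).
    apply: lee_wpmul2l; first by rewrite lee_fin invr_ge0 ltW.
    by apply: integral_chi2_ratioM_le => // x; [exact: g0|exact: g1].
  by rewrite muleA -EFinM mulVf ?gt_eqF// mul1e.
have hN0 z : 0 <= h (z.1 / z.2) * (`|z.1| + `|z.2|).
  by apply: mulr_ge0; [exact: g0|exact: addr_ge0].
rewrite -[leRHS]ge0_integralZl//; last 3 first.
- exact/measurable_EFinP.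
- by move=> z _; rewrite lee_fin.
- by rewrite lee_fin invr_ge0 ltW.
rewrite -ge0_integralZl//; last by rewrite lee_fin ltW.
apply: ge0_le_integral => //.
- by move=> z _; rewrite mule_ge0// lee_fin ltW.
- exact: emeasurable_funM.
- by apply: emeasurable_funM => //; exact/measurable_EFinP.
move=> z _; rewrite -!EFinM lee_fin.
have [x0|x0] := leP (z.1 / z.2) 0.
  by rewrite /b /h g_pos ?mul0r ?mulr0// pmulr_rle0.
(* Division by zero gives 0, so a positive ratio excludes [z.2 = 0]. *)
have z20 : z.2 != 0 by apply: contraTneq x0 => ->; rewrite invr0 mulr0 ltxx.
have xE : z.1 / z.2 * `|z.2| = `|z.1|.
  by rewrite -[X in X * _](gtr0_norm x0) -normrM divfK.
rewrite /b psiE -/E1.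
have -> : E1 * (h (z.1 / z.2) *
    ((1 + rho * (z.1 / z.2)) / (M * E1) * `|z.2|)) =
    M^-1 * (h (z.1 / z.2) * (`|z.2| + rho * `|z.1|)).
  rewrite -xE; field.
  by rewrite z20 !gt_eqF.
apply: ler_wpM2l; first by rewrite invr_ge0 ltW.
apply: ler_wpM2l; first exact: g0.
(* Here [rho <= 1] replaces [rho |u|] by [|u|], giving the symmetric weight [|u| + |v|]. *)
by rewrite addrC lerD2r ler_piMl.
Qed.

End weighted.
End scale_mixture.

(** * A pointwise identity for the entropy loss *)

Lemma entropy_loss_ge0 {R : realType} (x c : R) :
  0 < x -> 0 < c -> 0 <= entropy_loss x c.
Proof.
move=> x0 c0; rewrite /entropy_loss addrAC subr_ge0.
by apply: le_ln_sub1; exact: divr_gt0.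
Qed.

(** With [u = s / c], both sides equal [y u - ln (x u) - 1]. Splitting [- ln (x / y)] into the two
    bracketed terms on the left keeps each of them nonnegative when [x <= y]. *)
Lemma entropy_loss_exchange {R : realType} (x y s c : R) :
  0 < x -> 0 < y -> 0 < s -> 0 < c ->
  entropy_loss (y * s) c + (x / y - 1 - ln (x / y)) + (1 - x / y) =
  entropy_loss (x * s) c + (1 - x / y) * (y * (s / c)).
Proof.
move=> x0 y0 s0 c0; rewrite /entropy_loss -!(mulrA _ s).
have : 0 < s / c by exact: divr_gt0.
move: (s / c) => u u0; rewrite !lnM ?posrE ?invr_gt0// lnV ?posrE//.
by field; exact: lt0r_neq0.
Qed.

(** * Risk improvement at a fixed parameter *)

Section improvement.
Context {R : realType} {d : measure_display} {T : measurableType d}.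
Context {p q : nat} {m1 m2 : nat} {Pi : probability R R}.
Context {P : param R p q -> probability T R} {tau : {mfun T >-> R}}.
Context {X1 : {mfun T >-> p.-tuple R}} {S1 : {mfun T >-> R}}.
Context {X2 : {mfun T >-> q.-tuple R}} {S2 : {mfun T >-> R}}.
Hypothesis model : scale_mixture_model m1 m2 Pi P tau X1 S1 X2 S2.
Hypothesis m1_gt0 : (0 < m1)%N.
Hypothesis Pi_pos : Pi `]0, +oo[%classic = 1%E.
Hypothesis Pi_inv_fin : ('E_Pi[fun t : R => (t^-1)%R])%E \is a fin_num.
Variable pr : param R p q.
Hypothesis pr_adm : admissible pr.
Variable f : R -> R.
Hypotheses (mf : measurable_fun setT f) (f_gt0 : forall z, 0 < f z).
Local Notation s2 := (sigma2 pr).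
Local Notation psi := (psi11E m1 m2 Pi).
Let Z (w : T) := S1 w / S2 w.
Let Omega := @positive_scales _ _ _ S1 S2.

Definition improvable (z : R) : bool := (0 < z) && (f z < psi z).

(** The excess of [- ln x] over [1 - x] at [x = f z / psi z], positive for [x] other than 1 by
    strict concavity of [ln]. *)
Definition entropy_gain (z : R) : R :=
  if improvable z then f z / psi z - 1 - ln (f z / psi z) else 0.

Let psi_gt0 z : 0 < z -> 0 < psi z.
Proof.
move=> z0; rewrite /psi11E divr_gt0 ?addr_gt0// mulr_gt0 ?ltr0n ?addnS//.
exact: mixing_inv_gt0.
Qed.

Let mpsi : measurable_fun setT psi.
Proof. by apply: measurable_funM => //; exact: measurable_funD. Qed.

Let mquot : measurable_fun setT (fun z => f z / psi z).
Proof. exact: measurable_fun_div. Qed.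

Lemma measurable_improvable : measurable_fun setT improvable.
Proof. by apply: measurable_and; exact: measurable_fun_ltr. Qed.

Lemma measurable_entropy_gain : measurable_fun setT entropy_gain.
Proof.
apply: measurable_fun_ifT => //; first exact: measurable_improvable.
apply: measurable_funB; first exact: measurable_funB.
exact: (measurableT_comp (@measurable_ln R)).
Qed.

Lemma entropy_gain_gt0 z : improvable z -> 0 < entropy_gain z.
Proof.
move=> zA; rewrite /entropy_gain zA subr_gt0.
have /andP[/psi_gt0 psi0 fpsi] := zA.
apply: lt_ln_sub1; first exact: divr_gt0.
by rewrite lt_eqF// ltr_pdivrMr// mul1r.
Qed.

Lemma entropy_gain_ge0 z : 0 <= entropy_gain z.
Proof.
have [/entropy_gain_gt0/ltW//|zA] := boolP (improvable z).
by rewrite /entropy_gain (negbTE zA).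
Qed.

Let mZ : measurable_fun setT Z.
Proof. exact: measurable_fun_div. Qed.

Let s2_gt0 : 0 < s2 ^+ 2.
Proof. by case: pr_adm => *; exact: exprn_gt0. Qed.

Lemma measurable_entropy_loss (F : T -> R) (c : R) : measurable_fun setT F ->
  measurable_fun setT (fun w => entropy_loss (F w) c).
Proof.
move=> mF; have mFc : measurable_fun setT (fun w => F w / c).
  exact: measurable_funM.
apply: measurable_funB => //; apply: measurable_funB => //.
exact: (measurableT_comp (@measurable_ln R)).
Qed.

(** Integrating [entropy_loss_exchange] leaves [g] on the left and [b] on the right;
    [expectation_psi11E_le] bounds the integral of [b] by that of [g], which is finite and hence
    cancels. *)
Lemma entropy_risk_gain_le :
  (\int[P pr]_(w in Omega)
     (entropy_loss (Num.max (f (Z w)) (psi (Z w)) * S2 w) (s2 ^+ 2))%:E +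
   \int[P pr]_(w in Omega) (entropy_gain (Z w))%:E <=
   \int[P pr]_(w in Omega) (entropy_loss (f (Z w) * S2 w) (s2 ^+ 2))%:E)%E.
Proof.
pose g z := if improvable z then 1 - f z / psi z else 0.
have mg : measurable_fun setT g.
  apply: measurable_fun_ifT => //; first exact: measurable_improvable.
  exact: measurable_funB.
have g01 z : 0 <= g z <= 1.
  rewrite /g; case: ifP => [/andP[/psi_gt0 psi0 fpsi]|_]; last first.
    by rewrite lexx ler01.
  rewrite subr_ge0 ler_pdivrMr// mul1r (ltW fpsi)/=.
  by rewrite gerBl divr_ge0 ?ltW.
have g0 z : 0 <= g z by have /andP[] := g01 z.
have g1 z : g z <= 1 by have /andP[] := g01 z.
have g_pos z : z <= 0 -> g z = 0.
  by move=> z0; rewrite /g /improvable ltNge z0.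
have mO : measurable Omega by exact: measurable_positive_scales.
have PO : P pr (~` Omega) = 0%E by exact: (positive_scales_full model).
have gpsi0 z b : 0 <= b -> 0 <= g z * (psi z * b).
  move=> b0; have [z0|z0] := leP z 0; first by rewrite g_pos ?mul0r.
  by apply: mulr_ge0 => //; apply: mulr_ge0 => //; exact/ltW/psi_gt0.
pose L' w := entropy_loss (Num.max (f (Z w)) (psi (Z w)) * S2 w) (s2 ^+ 2).
pose L w := entropy_loss (f (Z w) * S2 w) (s2 ^+ 2).
pose b w := g (Z w) * (psi (Z w) * (`|S2 w| / s2 ^+ 2)).
have mfZ : measurable_fun setT (fun w => f (Z w)).
  exact: (measurableT_comp mf).
have mpsiZ : measurable_fun setT (fun w => psi (Z w)).
  exact: (measurableT_comp mpsi).
have mEL : measurable_fun Omega (fun w => (L w)%:E).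
  apply/measurable_EFinP/measurable_funTS/measurable_entropy_loss.
  exact: measurable_funM.
have mEL' : measurable_fun Omega (fun w => (L' w)%:E).
  apply/measurable_EFinP/measurable_funTS/measurable_entropy_loss.
  by apply: measurable_funM => //; exact: measurable_maxr.
have mEg : measurable_fun setT (fun w => (g (Z w))%:E).
  by apply/measurable_EFinP; exact: (measurableT_comp mg).
have mEj : measurable_fun setT (fun w => (entropy_gain (Z w))%:E).
  apply/measurable_EFinP; apply: (measurableT_comp measurable_entropy_gain).
  exact: mZ.
have mEb : measurable_fun setT (fun w => (b w)%:E).
  apply/measurable_EFinP; apply: measurable_funM.
    exact: (measurableT_comp mg).
  apply: measurable_funM => //; apply: measurable_funM => //.
  exact: measurableT_comp.
have L0 w : Omega w -> 0 <= L w.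
  by case=> _ S20; apply: entropy_loss_ge0 => //; exact: mulr_gt0.
have L'0 w : Omega w -> 0 <= L' w.
  case=> _ S20; apply: entropy_loss_ge0 => //; apply: mulr_gt0 => //.
  by rewrite lt_max f_gt0.
have pointwise w : Omega w ->
    L' w + entropy_gain (Z w) + g (Z w) = L w + b w.
  case=> S10 S20; rewrite /L' /L /b /g /entropy_gain.
  (* Where no improvement occurs, the maximum is [f] and all correction terms vanish. *)
  case: ifP => [/andP[Z0 fpsi]|/negbT]; last first.
    rewrite negb_and -leNgt leNgt divr_gt0//= -leNgt => /max_idPl ->.
    by rewrite mul0r !addr0.
  have psi0 := psi_gt0 _ Z0; have f0 := f_gt0 (Z w).
  by rewrite (max_idPr (ltW fpsi)) gtr0_norm// entropy_loss_exchange.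
rewrite -/L' -/L.
have Ig : (\int[P pr]_(w in Omega) (g (Z w))%:E)%E \is a fin_num.
  rewrite ge0_fin_numE; last by apply: integral_ge0 => w _; rewrite lee_fin.
  apply: (@le_lt_trans _ _ (\int[P pr]_(w in Omega) 1)%E).
    apply: ge0_le_integral => //.
    - by move=> w _; rewrite lee_fin.
    - exact: measurable_funTS.
    - by move=> w _; rewrite lee_fin.
  by rewrite integral_cst// mul1e (le_lt_trans (probability_le1 _ _))// ltry.
rewrite -(leeD2rE _ _ Ig).
have mE (h : T -> \bar R) : measurable_fun setT h -> measurable_fun Omega h.
  by move=> mh; exact: measurable_funTS.
have -> : (\int[P pr]_(w in Omega) (L' w)%:E +
    \int[P pr]_(w in Omega) (entropy_gain (Z w))%:E +
    \int[P pr]_(w in Omega) (g (Z w))%:E =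
    \int[P pr]_(w in Omega) (L w)%:E + \int[P pr]_(w in Omega) (b w)%:E)%E.
  rewrite -!ge0_integralD//; try by [exact: mE|move=> w Ow; rewrite lee_fin
    ?L0 ?L'0 ?entropy_gain_ge0 ?gpsi0 ?divr_ge0 ?ltW].
  - apply: eq_integral => w /[!inE] Ow.
    by rewrite -!EFinD pointwise.
  - by move=> w Ow; rewrite lee_fin; apply: gpsi0; rewrite divr_ge0// ltW.
  - move=> w Ow; rewrite -EFinD lee_fin addr_ge0 ?L'0//.
    exact: entropy_gain_ge0.
  - by apply: emeasurable_funD => //; exact: mE.
  - by move=> w _; rewrite lee_fin.
rewrite leeD2l// -!(integral_full_measure _ _ mO PO).
exact: (expectation_psi11E_le model).
Qed.

Lemma integral_entropy_gain_gt0 :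
  (0 < P pr [set w | improvable (Z w)])%E ->
  (0 < \int[P pr]_(w in Omega) (entropy_gain (Z w))%:E)%E.
Proof.
pose A := [set w | improvable (Z w)].
have mA : measurable A.
  have mAZ : measurable_fun setT (improvable \o Z).
    exact: (measurableT_comp measurable_improvable).
  rewrite (_ : A = setT `&` (improvable \o Z) @^-1` [set true]).
    exact: mAZ.
  by rewrite setTI.
have mO : measurable Omega by exact: measurable_positive_scales.
have PO : P pr (~` Omega) = 0%E by exact: (positive_scales_full model).
have mgain : measurable_fun setT (fun w => (entropy_gain (Z w))%:E).
  apply/measurable_EFinP; apply: (measurableT_comp measurable_entropy_gain).
  exact: mZ.
(* A ratio is positive also for two negative scales, so [A] may leave [Omega]; the integral is first
   extended to the whole space. *)
move=> PA; rewrite -(integral_full_measure _ _ mO PO).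
apply: (@lt_le_trans _ _ (\int[P pr]_(w in A) (entropy_gain (Z w))%:E)%E).
  apply: integral_gt0 => //; first exact: measurable_funTS.
  by move=> w Aw; rewrite lte_fin entropy_gain_gt0.
apply: ge0_subset_integral => //.
by move=> w _; rewrite lee_fin entropy_gain_ge0.
Qed.

End improvement.

(** * Domination of the original estimator over all admissible parameters *)

Theorem theorem3p2 (R : realType) (d : measure_display) (T : measurableType d)
  (p q m1 m2 : nat)
  (p_gt0 : (0 < p)%N) (q_gt0 : (0 < q)%N)
  (m1_gt0 : (0 < m1)%N) (m2_gt0 : (0 < m2)%N)
  (Pi : probability R R)
  (Pi_pos : Pi `]0, +oo[%classic = 1%E)
  (Pi_inv_fin : ('E_Pi[fun t : R => (t^-1)%R])%E \is a fin_num)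
  (P : param R p q -> probability T R)
  (tau : {mfun T >-> R})
  (X1 : {mfun T >-> p.-tuple R}) (S1 : {mfun T >-> R})
  (X2 : {mfun T >-> q.-tuple R}) (S2 : {mfun T >-> R})
  (model : scale_mixture_model m1 m2 Pi P tau X1 S1 X2 S2)
  (psi1 : R -> R)
  (psi1_meas : measurable_fun (`]0, +oo[%classic : set R) psi1)
  (psi1_pos : forall z, 0 < z -> 0 < psi1 z) :
  let Z1 := fun w : T => S1 w / S2 w in
  let delta_psi1 := fun w : T => psi1 (Z1 w) * S2 w in
  let delta_S1 :=
    fun w : T => Num.max (psi1 (Z1 w)) (psi11E m1 m2 Pi (Z1 w)) * S2 w in
  (forall pr, admissible pr -> risk P delta_psi1 pr \is a fin_num) ->
  forall pr0, admissible pr0 ->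
  (0 < P pr0 [set w | (0 < Z1 w)%R /\ (psi1 (Z1 w) < psi11E m1 m2 Pi (Z1 w))%R])%E ->
  dominates P delta_S1 delta_psi1.
Proof.
move=> Z1 delta_psi1 delta_S1 risk_fin pr0 pr0_adm P0.
(* Extending [psi1] by 1 gives a positive function measurable on the whole line, equal to [psi1] at
   every ratio of positive scales. *)
pose f z := if 0 < z then psi1 z else 1.
have mf : measurable_fun setT f.
  apply: measurable_fun_if => //; first exact: measurable_fun_ltr.
  apply: measurable_funS psi1_meas => //.
  by move=> z [_ /=]; rewrite in_itv/= andbT.
have f_gt0 z : 0 < f z by rewrite /f; case: ifP => // /psi1_pos.
pose Omega := @positive_scales _ _ _ S1 S2.
have mO : measurable Omega by exact: measurable_positive_scales.
have fE w : Omega w -> f (Z1 w) = psi1 (Z1 w).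
  by case=> S10 S20; rewrite /f divr_gt0.
(* [F] stands for both estimators: the first projection gives [delta_psi1], the maximum with
   [psi11E] gives [delta_S1]. *)
have riskE pr (F : R -> R -> R) : admissible pr ->
    risk P (fun w => F (psi1 (Z1 w)) (Z1 w) * S2 w) pr =
    (\int[P pr]_(w in Omega)
      (entropy_loss (F (f (Z1 w)) (Z1 w) * S2 w) (sigma2 pr ^+ 2))%:E)%E.
  move=> pr_adm.
  rewrite /risk unlock (integral_full_measure _ _ mO); last first.
    exact: (positive_scales_full model).
  by apply: eq_integral => w /[!inE] Ow; rewrite fE.
have gain pr (pr_adm : admissible pr) : (risk P delta_S1 pr +
    \int[P pr]_(w in Omega) (entropy_gain (m1 := m1) (m2 := m2) (Pi := Pi)
      f (Z1 w))%:E <= risk P delta_psi1 pr)%E.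
  rewrite [X in (X + _ <= _)%E](riskE pr
    (fun x z => Num.max x (psi11E m1 m2 Pi z)) pr_adm).
  rewrite [leRHS](riskE pr (fun x z => x) pr_adm).
  exact: (entropy_risk_gain_le model).
have gain0 pr : (0 <= \int[P pr]_(w in Omega)
    (entropy_gain (m1 := m1) (m2 := m2) (Pi := Pi) f (Z1 w))%:E)%E.
  by apply: integral_ge0 => w _; rewrite lee_fin; exact: entropy_gain_ge0.
split.
  by move=> pr pr_adm; apply: le_trans (gain pr pr_adm); rewrite leeDl.
exists pr0; split => //.
have risk0 : (0 <= risk P delta_S1 pr0)%E.
  rewrite [leRHS](riskE pr0
    (fun x z => Num.max x (psi11E m1 m2 Pi z)) pr0_adm).
  apply: integral_ge0 => w [_ S20]; rewrite lee_fin entropy_loss_ge0//.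
    by rewrite mulr_gt0// lt_max f_gt0.
  by case: pr0_adm => *; exact: exprn_gt0.
(* Adding a positive amount is strict only at a finite risk; the new risk is bounded by the old one,
   which is assumed finite. *)
have risk_S1_fin : risk P delta_S1 pr0 \is a fin_num.
  rewrite ge0_fin_numE//; apply: (@le_lt_trans _ _ (risk P delta_psi1 pr0)).
    by apply: le_trans (gain pr0 pr0_adm); rewrite leeDl.
  by rewrite -ge0_fin_numE ?risk_fin// (le_trans _ (gain _ _))// adde_ge0.
apply: lt_le_trans (gain pr0 pr0_adm); rewrite lteDl//.
apply: (integral_entropy_gain_gt0 model) => //.
apply: lt_le_trans P0 _; rewrite le_eqVlt; apply/orP; left; apply/eqP.
congr (P pr0 _); apply/seteqP; split => w /=; rewrite /improvable /f.
  by case=> -> ->.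
by move=> /andP[Z0]; rewrite Z0.
Qed.
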